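(* Let $q$ be a prime power, $E=\mathbb{F}_q^n$, and $1<k_1<k_2<n$ with $k_1+k_2\ge n$. Let $\mathcal{M}_1=\mathcal{U}_{k_1,n}(q)$ and $\mathcal{M}_2=\mathcal{U}_{k_2,n}(q)$. Let $a,\mu$ be integers with $a\ge1$, $\mu\ge2$, let $\lambda=\frac{a}{\mu}$ with $0<\lambda<1$, and let $\mathcal{M}=(1-\lambda)\mathcal{M}_1+\lambda\mathcal{M}_2$. Then $\mathcal{I}_\mu(\mathcal{M})=\mathcal{L}(E)$.
   Context: $\mathcal{L}(E)$ is the lattice of subspaces of $E$. The uniform $q$-matroid $\mathcal{U}_{k,n}(q)$ has rank function $\rho(V)=\min\{k,\dim V\}$. $(1-\lambda)\mathcal{M}_1+\lambda\mathcal{M}_2$ is the $q$-polymatroid with rank function $(1-\lambda)\rho_1+\lambda\rho_2$. A space $I$ is $\mu$-independent if $\rho(J)\ge\dim(J)/\mu$ for all $J\le I$; $\mathcal{I}_\mu(\mathcal{M})$ is the set of $\mu$-independent spaces. *)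

(* Defs.v *)
From HB Require Import structures.
From mathcomp Require Import all_boot all_order all_algebra.
From mathcomp Require Import classical_sets.
From mathcomp Require Import zify lra.
Set Implicit Arguments.
Unset Strict Implicit.
Unset Printing Implicit Defensive.
Import Order.TTheory GRing.Theory Num.Theory.

Local Open Scope ring_scope.
Local Open Scope classical_set_scope.

(* Rank functions take values in an arbitrary ordered field R, which covers
   both the rational-valued and the real-valued conventions for
   q-polymatroids; q is the order of F. *)
Record qpolymatroid (R : realFieldType) (F : finFieldType) (E : vectType F) :=
  QPolymatroid {
    rk :> {vspace E} -> R;
    rk_bound : forall V, 0 <= rk V <= (\dim V)%:R;
    rk_mono : forall V W, (V <= W)%VS -> rk V <= rk W;
    rk_submod : forall V W, rk (V + W)%VS + rk (V :&: W)%VS <= rk V + rk W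
  }.

Section Uniform.
Variables (R : realFieldType) (F : finFieldType) (E : vectType F) (k : nat).

Definition uniform_rk (V : {vspace E}) : R := (minn k (\dim V))%:R.

Lemma uniform_rk_bound V : 0 <= uniform_rk V <= (\dim V)%:R.
Proof. by rewrite ler0n ler_nat geq_minr. Qed.

Lemma uniform_rk_mono V W : (V <= W)%VS -> uniform_rk V <= uniform_rk W.
Proof. by move=> /dimvS leVW; rewrite ler_nat; lia. Qed.

Lemma uniform_rk_submod V W :
  uniform_rk (V + W)%VS + uniform_rk (V :&: W)%VS
    <= uniform_rk V + uniform_rk W.
Proof.
rewrite -!natrD ler_nat.
have := dimv_sum_cap V W.
have := dimvS (capvSl V W); have := dimvS (capvSr V W); lia.
Qed.

Definition uniform_qmatroid : qpolymatroid R E :=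
  QPolymatroid uniform_rk_bound uniform_rk_mono uniform_rk_submod.

End Uniform.

Section ConvexCombination.
Variables (R : realFieldType) (F : finFieldType) (E : vectType F).
Variables (lam : R) (lam01 : 0 < lam < 1) (M1 M2 : qpolymatroid R E).

Definition conv_rk (V : {vspace E}) : R := (1 - lam) * M1 V + lam * M2 V.

Lemma conv_rk_bound V : 0 <= conv_rk V <= (\dim V)%:R.
Proof.
have /andP[? ?] := rk_bound M1 V; have /andP[? ?] := rk_bound M2 V.
by case/andP: lam01 => ? ?; rewrite /conv_rk; apply/andP; split; nra.
Qed.

Lemma conv_rk_mono V W : (V <= W)%VS -> conv_rk V <= conv_rk W.
Proof.
move=> VW; have ? := rk_mono M1 VW; have ? := rk_mono M2 VW.
by case/andP: lam01 => ? ?; rewrite /conv_rk; nra.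
Qed.

Lemma conv_rk_submod V W :
  conv_rk (V + W)%VS + conv_rk (V :&: W)%VS <= conv_rk V + conv_rk W.
Proof.
have ? := rk_submod M1 V W; have ? := rk_submod M2 V W.
by case/andP: lam01 => ? ?; rewrite /conv_rk; nra.
Qed.

Definition conv_qpolymatroid : qpolymatroid R E :=
  QPolymatroid conv_rk_bound conv_rk_mono conv_rk_submod.

End ConvexCombination.

Section Independence.
Variables (R : realFieldType) (F : finFieldType) (E : vectType F).
Variables (mu : nat) (M : qpolymatroid R E).

Definition mu_independent (I : {vspace E}) : Prop :=
  forall J : {vspace E}, (J <= I)%VS -> (\dim J)%:R / mu%:R <= M J.

Definition mu_independents : set {vspace E} := [set I | mu_independent I].

End Independence.

Definition subspace_lattice (F : finFieldType) (E : vectType F) :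
  set {vspace E} := [set: {vspace E}].
Arguments subspace_lattice {F} E _.

(* Main.v *)
(** Multiplying by [mu], independence of a space of dimension [d] reads
    [d <= (mu - a) * min k1 d + a * min k2 d].  Both weights are at least [1],
    so the right-hand side is at least [min k1 d + min k2 d], which is at
    least [d] because [d <= n <= k1 + k2]. *)

Require Import Defs.
From HB Require Import structures.
From mathcomp Require Import all_boot all_order all_algebra.
From mathcomp Require Import classical_sets.
From mathcomp Require Import zify ring.
Set Implicit Arguments.
Unset Strict Implicit.
Unset Printing Implicit Defensive.
Import Order.TTheory GRing.Theory Num.Theory.
Local Open Scope ring_scope.

Theorem theorem6p2 (R : realFieldType) (F : finFieldType) (n k1 k2 : nat)
    (hk1 : (1 < k1)%N) (hk12 : (k1 < k2)%N) (hk2 : (k2 < n)%N)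
    (hn : (n <= k1 + k2)%N)
    (a mu : nat) (ha : (1 <= a)%N) (hmu : (2 <= mu)%N)
    (lam : R) (hlam : lam = a%:R / mu%:R) (lam01 : 0 < lam < 1) :
  let M1 := uniform_qmatroid R 'rV[F]_n k1 in
  let M2 := uniform_qmatroid R 'rV[F]_n k2 in
  let M := conv_qpolymatroid lam01 M1 M2 in
  mu_independents mu M = subspace_lattice 'rV[F]_n.
Proof.
(* Inclusion in the full lattice is trivial; for the converse, the rank bound is shown for every
   subspace [J]. *)
move=> M1 M2 M; apply/seteqP; split=> // I _ J _.
have mu_gt0 : 0 < mu%:R :> R by rewrite ltr0n; lia.
have a_lt_mu : (a < mu)%N.
  by have /andP[_] := lam01; rewrite hlam ltr_pdivrMr // mul1r ltr_nat.
have dimJ : (\dim J <= n)%N.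
  by rewrite (leq_trans (dimvS (subvf J))) // dimvf /dim /= mul1n.
rewrite /= /conv_rk /= /uniform_rk ler_pdivrMr //.
(* As [lam * mu = a], the scaled rank is a natural number and the inequality descends to [nat];
   [a < mu] makes the truncated [mu - a] a true difference. *)
have -> : ((1 - lam) * (minn k1 (\dim J))%:R + lam * (minn k2 (\dim J))%:R)
    * mu%:R = ((mu - a) * minn k1 (\dim J) + a * minn k2 (\dim J))%:R :> R.
  rewrite natrD !natrM natrB 1?ltnW // hlam.
  by field; rewrite gt_eqF.
(* If [\dim J <= k2], the second minimum alone is [\dim J]; otherwise the minima are [k1] and
   [k2]. *)
rewrite ler_nat (@leq_trans (minn k1 (\dim J) + minn k2 (\dim J))%N) //; first lia.
by apply: leq_add; rewrite leq_pmull // subn_gt0.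
Qed.
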